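(* Let $X$ be a real Hilbert space, $T>0$, $u_0\in X$, and let $\mathcal{F}:(0,T]\times X\to X$ be a possibly nonlinear operator satisfying $$\langle \mathcal{F}(t,v),v\rangle_X=0\qquad\forall v\in X,\ \forall t\in(0,T].$$ Let $0=t_0<t_1<\dots<t_M=T$ be a time partition with time steps $I_m=(t_{m-1},t_m)$, and let $\bm r=\{r_m\}_{m=1}^M$ be a vector of polynomial degrees $r_m\ge 1$. Then any solution $U$ of the continuous Galerkin scheme, i.e., any continuous function $U:[0,T]\to X$ with $U|_{I_m}\in\mathbb{P}^{r_m}(I_m;X)$ for $m=1,\dots,M$, $U(0)=u_0$, and $$\int_{I_m}\langle \dot U(t)-\mathcal{F}(t,(\Pi^{r_m-1}U)(t)),V(t)\rangle_X\,\mathrm{d}t=0\qquad\forall V\in\mathbb{P}^{r_m-1}(I_m;X),\quad m=1,\dots,M,$$ satisfies $\{U(t_m)\}_{m=0}^M\subset\{v\in X:\ \|v\|_X=\|u_0\|_X\}$, that is, $\|U(t_m)\|_X=\|u_0\|_X$ for all $m=0,1,\dots,M$.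
   Context: $\langle\cdot,\cdot\rangle_X$ and $\|\cdot\|_X$ are the inner product and induced norm of $X$. For an interval $I$ and $r\in\mathbb{N}_0$, $\mathbb{P}^r(I;X)$ is the space of polynomials $p(t)=\sum_{i=0}^r x_i t^i$ on $\overline I$ with coefficients $x_i\in X$. $L^2(I;X)$ is the usual Bochner space. $\Pi^{r_m-1}:L^2(I_m;X)\to\mathbb{P}^{r_m-1}(I_m;X)$ is the $L^2$-projection on $I_m$, defined by $\int_{I_m}\langle W-\Pi^{r_m-1}W,V\rangle_X\,\mathrm{d}t=0$ for all $V\in\mathbb{P}^{r_m-1}(I_m;X)$. $\dot U$ is the (piecewise) time derivative of $U$. It is understood that $t\mapsto\mathcal{F}(t,(\Pi^{r_m-1}U)(t))$ belongs to $L^2(I_m;X)$ for each $m$. *)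

(* Defs.v *)
From mathcomp Require Import all_boot all_order all_algebra.
From mathcomp Require Import all_classical all_reals all_analysis.

Set Implicit Arguments.
Unset Strict Implicit.
Unset Printing Implicit Defensive.

Import Order.TTheory GRing.Theory Num.Theory.
Import numFieldNormedType.Exports.

Local Open Scope classical_set_scope.
Local Open Scope ring_scope.

(* A real Hilbert space is a [completeNormedModType R] together with a dot
   product [ip : {dot X for idfun}] (bilinear, symmetric, positive definite)
   inducing its norm. Functions on an interval I are total functions
   on the line of which only the values on I are relevant. *)

Definition induced_norm (R : realType) (X : normedModType R)
    (ip : {dot X for idfun}) : Prop :=
  forall x : X, `|x| = Num.sqrt (ip x x).

(* P^r(I; X). On a nondegenerate open interval I, the coefficients are unique,
   so such a function has a unique polynomial extension to the closure of I. *)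
Definition polyfun (R : realType) (X : normedModType R) (I : set R) (r : nat) :
    set (R -> X) :=
  [set p | exists x : 'I_r.+1 -> X,
     forall t, I t -> p t = \sum_(i < r.+1) t ^+ i *: x i].

Definition simple_fun (R : realType) (X : normedModType R) (s : R -> X) : Prop :=
  finite_set (range s) /\ forall x : X, measurable (s @^-1` [set x]).

Definition strongly_measurable (R : realType) (X : normedModType R)
    (I : set R) (f : R -> X) : Prop :=
  exists2 s : nat -> R -> X, forall n, simple_fun (s n) &
    {ae @lebesgue_measure R, forall t, I t -> s n t @[n --> \oo] --> f t}.

(* L^2(I; X). [lebesgue_measure] lives on the Borel sets, hence |f|^2 need only
   agree almost everywhere with a Borel function; the integral of a nonnegative
   function, being a supremum over simple functions below it, has the expected
   value in that case. *)
Definition BochnerL2 (R : realType) (X : normedModType R) (I : set R) :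
    set (R -> X) :=
  [set f | strongly_measurable I f /\
     (\int[lebesgue_measure]_(t in I) (`|f t| ^+ 2)%:E < +oo)%E].

(* The L^2-projection Pi^r : L^2(I; X) -> P^r(I; X): the element of P^r(I; X)
   (unique on I) whose difference to W is orthogonal to P^r(I; X). [fun=> 0] is
   a dummy default. *)
Definition L2proj (R : realType) (X : normedModType R) (ip : {dot X for idfun})
    (I : set R) (r : nat) (W : R -> X) : R -> X :=
  xget (fun=> 0) [set P | polyfun I r P /\
    forall V, polyfun I r V ->
      (\int[lebesgue_measure]_(t in I) (ip (W t - P t) (V t))%:E = 0)%E].

(* 0 = tau_0 < tau_1 < ... < tau_M = T; values of tau beyond M are irrelevant. *)
Definition time_partition (R : realType) (T : R) (M : nat) (tau : nat -> R) :
    Prop :=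
  [/\ tau 0%N = 0, tau M = T & forall m, (m < M)%N -> tau m < tau m.+1].

(* I_m, to be used for 1 <= m <= M. *)
Definition step (R : realType) (tau : nat -> R) (m : nat) : set R :=
  `]tau m.-1, tau m[%classic.

(* Continuous Galerkin scheme with degrees r_1, ..., r_M on [0, T]; [derive1 U]
   is the derivative of U; on the open I_m it only depends on U there. *)
Record cG_solution (R : realType) (X : normedModType R)
    (ip : {dot X for idfun}) (F : R -> X -> X) (u0 : X) (T : R) (M : nat)
    (tau : nat -> R) (r : nat -> nat) (U : R -> X) : Prop := {
  cG_continuous : {within `[0, T], continuous U} ;
  cG_poly : forall m, (0 < m <= M)%N -> polyfun (step tau m) (r m) U ;
  cG_init : U 0 = u0 ;
  cG_scheme : forall m, (0 < m <= M)%N ->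
    forall V, polyfun (step tau m) (r m).-1 V ->
      (\int[lebesgue_measure]_(t in step tau m)
         (ip (derive1 U t - F t (L2proj ip (step tau m) (r m).-1 U t)) (V t))%:E
       = 0)%E }.

(* Main.v *)
From HB Require Import structures.
Require Import Defs.
From mathcomp Require Import all_boot all_order all_algebra.
From mathcomp Require Import all_classical all_reals all_analysis measurable_realfun.

(** On one time step ]a, b[, write P for the L2-projection of U onto the
    polynomials of degree at most r - 1. Three facts give |U b| = |U a|:

    - testing the scheme with V := P kills the nonlinearity pointwise, since
      <F(t, P t), P t> = 0; hence the integral of <U', P> vanishes;
    - U' has degree at most r - 1, so it is an admissible test function in the
      definition of P, and the integral of <U - P, U'> vanishes as well;
    - adding up, the integral of 2 <U', U>, which is the derivative of |U|^2,
      vanishes.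

    Continuity of U carries this from the open steps to their end points, and
    induction on the steps concludes.

    The projection is given by a choice operator, so its existence has to be
    established ([L2proj_polyfun]). Only polynomials W = sum_i t^i x_i have to
    be projected, and for these it suffices to project the scalar monomials t^i
    ([scalar_projection], by invertibility of the Gram matrix of the monomials),
    keeping the coefficients x_i. Every integrand is a scalar polynomial
    ([ip_sum_horner]), so all integration goes through the linear functional
    [pint] on {poly R}, evaluated by antiderivatives. *)

Import Order.TTheory GRing.Theory Num.Theory.
Import numFieldNormedType.Exports.

Local Open Scope classical_set_scope.
Local Open Scope ring_scope.

(** * Scalar polynomials *)

Lemma poly_antiderivative (K : numFieldType) (p : {poly K}) :
  exists q : {poly K}, q^`() = p.
Proof.
exists (\poly_(i < (size p).+1) (p`_i.-1 / i%:R)).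
apply/polyP => i; rewrite coef_deriv coef_poly ltnS /=.
case: ltnP => [_|szp]; last by rewrite mul0rn nth_default.
by rewrite -[LHS]mulr_natr divfK ?pnatr_eq0.
Qed.

Lemma poly_eq0_itv (K : numFieldType) (a b : K) (p : {poly K}) : a < b ->
  (forall t, a < t < b -> p.[t] = 0) -> p = 0.
Proof.
move=> ab p0; apply/eqP; apply: contraT => p_neq0.
(* Infinitely many points of ]a, b[, more than p can have roots. *)
pose z (k : nat) := a + (b - a) / k.+2%:R.
have ba0 : b - a != 0 by rewrite subr_eq0 gt_eqF.
have z_inj : injective z.
  move=> i j /addrI /(mulfI ba0) /invr_inj /eqP.
  by rewrite eqr_nat => /eqP[].
have /= := @max_poly_roots _ p (map z (iota 0 (size p))) p_neq0.
rewrite size_map size_iota ltnn => -> //; last first.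
  by rewrite map_inj_uniq ?iota_uniq.
apply/allP => _ /mapP[k _ ->]; apply/rootP/p0.
rewrite /z ltrDl divr_gt0 ?subr_gt0 ?ltr0n//=.
by rewrite -ltrBrDl gtr_pMr ?subr_gt0// invf_lt1 ?ltr0n// ltr1n.
Qed.

(** * Integration of polynomials and projection onto lower degrees *)

Section PolynomialIntegral.
Context {R : realType} {a b : R}.
Hypothesis ab : a < b.
Local Notation mu := (@lebesgue_measure R).

Definition pint (p : {poly R}) : R :=
  fine (\int[mu]_(t in `]a, b[) (p.[t])%:E)%E.

Lemma integral_horner_deriv (q : {poly R}) :
  (\int[mu]_(t in `]a, b[) (q^`().[t])%:E = (q.[b] - q.[a])%:E)%E.
Proof.
have mq : measurable_fun `]a, b[ (EFin \o horner q^`()).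
  by apply: measurableT_comp => //; exact: measurable_poly.
rewrite -(integral_itv_bndoo true false mq).
rewrite EFinB; apply: (@continuous_FTC2 _ (horner q^`()) (horner q)) => //.
- exact/continuous_subspaceT/continuous_horner.
- split=> [t _||]; first exact: derivable_horner.
  + exact/cvg_at_right_filter/continuous_horner.
  + exact/cvg_at_left_filter/continuous_horner.
- by move=> t _; rewrite derivE.
Qed.

Lemma pint_deriv (q : {poly R}) : pint q^`() = q.[b] - q.[a].
Proof. by rewrite /pint integral_horner_deriv. Qed.

Lemma integral_horner (p : {poly R}) :
  (\int[mu]_(t in `]a, b[) (p.[t])%:E = (pint p)%:E)%E.
Proof.
by have [q <-] := poly_antiderivative _ p; rewrite pint_deriv integral_horner_deriv.
Qed.

Lemma pint_is_linear : linear pint.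
Proof.
move=> c p1 p2; have [q1 <-] := poly_antiderivative _ p1.
have [q2 <-] := poly_antiderivative _ p2.
rewrite -derivZ -derivD !pint_deriv !hornerE /=.
by rewrite -[c *: _]/(c * _) mulrBr opprD addrACA !addrA.
Qed.
HB.instance Definition _ := GRing.isLinear.Build R {poly R} R _ pint pint_is_linear.

(** An antiderivative q of p^2 is nondecreasing; if its values at a and b agree,
    it is constant on [a, b], hence constant as a polynomial, and p^2 = 0. *)
Lemma pint_sqr_eq0 (p : {poly R}) : pint (p * p) = 0 -> p = 0.
Proof.
have [q dq] := poly_antiderivative _ (p * p).
rewrite -dq pint_deriv => /eqP; rewrite subr_eq0 => /eqP qba.
have q_le : {in `[a, b]%R &, {homo horner q : x y / x <= y}}.
  apply: ger0_derive1_le_cc.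
  - by move=> t _; exact: derivable_horner.
  - by move=> t _; rewrite -derivE dq hornerM -expr2 sqr_ge0.
  - exact/continuous_subspaceT/continuous_horner.
have : q - q.[a]%:P = 0.
  apply: poly_eq0_itv ab _ => t /andP[/ltW at_ /ltW tb].
  apply/eqP; rewrite !hornerE subr_eq0 eq_le -{1}qba.
  by rewrite !q_le ?in_itv/= ?lexx ?at_ ?tb ?(ltW ab).
move=> /(congr1 (@deriv _)); rewrite derivB derivC subr0 deriv0 dq => /eqP.
by rewrite mulf_eq0 orbb => /eqP.
Qed.

(** The Gram matrix of the monomials of degree less than n is invertible: a
    vector in its kernel is the coefficient vector of a polynomial orthogonal to
    all monomials, hence to itself, so [pint_sqr_eq0] applies. The coefficients
    of the projection solve the normal equations. *)
Lemma scalar_projection (n : nat) (p : {poly R}) :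
  exists2 q : {poly R}, (size q <= n)%N &
    forall j, (j < n)%N -> pint ((p - q) * 'X^j) = 0.
Proof.
pose G : 'M[R]_n := \matrix_(i, j) pint ('X^i * 'X^j).
have mulG (v : 'rV[R]_n) j : (v *m G) 0 j = pint (rVpoly v * 'X^j).
  rewrite mxE [rVpoly v]poly_def mulr_suml linear_sum; apply: eq_bigr => i _.
  by rewrite valK -scalerAl linearZ mxE.
have Gu : G \in unitmx.
  rewrite -row_free_unit; apply: inj_row_free => v vG0.
  apply: (can_inj (@rVpolyK _ _)); rewrite linear0; apply: pint_sqr_eq0.
  rewrite {2}[rVpoly v]poly_def mulr_sumr linear_sum big1// => j _.
  by rewrite valK -scalerAr linearZ/= -mulG vG0 mxE scaler0.
pose d : 'rV[R]_n := \row_j pint (p * 'X^j).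
exists (rVpoly (d *m invmx G)) => [|j jn]; first exact: size_poly.
rewrite mulrBl linearB/= -[j]/(nat_of_ord (Ordinal jn)) -mulG mulmxKV// mxE.
exact: subrr.
Qed.

End PolynomialIntegral.

(** * Polynomials with values in a normed space *)

Section VectorPolynomials.
Context {R : realType} {X : normedModType R} (ip : {dot X for idfun}).

(** Functions of the form sum_i e_i(t) x_i, with scalar polynomials e_i, cover
    U, its derivative and its projection alike, and the inner product of two of
    them is a scalar polynomial. *)
Lemma ip_sum_horner (n m : nat) (e : 'I_n -> {poly R}) (x : 'I_n -> X)
    (d : 'I_m -> {poly R}) (y : 'I_m -> X) (t : R) :
  ip (\sum_i (e i).[t] *: x i) (\sum_j (d j).[t] *: y j) =
  (\sum_i \sum_j ip (x i) (y j) *: (e i * d j)).[t].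
Proof.
rewrite linear_sumlz horner_sum; apply: eq_bigr => i _.
rewrite linear_sumr horner_sum; apply: eq_bigr => j _.
by rewrite linearZl_LR linearZ /= !hornerE /= mulrC mulrA.
Qed.

Lemma polyfunP (I : set R) (r : nat) (f : R -> X) : polyfun I r f <->
  exists x : 'I_r.+1 -> X, forall t, I t ->
    f t = \sum_(i < r.+1) ('X^i : {poly R}).[t] *: x i.
Proof.
by split=> -[x fx]; exists x => t /fx ->; apply: eq_bigr => i _; rewrite hornerXn.
Qed.

Lemma polyfun_sum_horner (I : set R) (r n : nat) (e : 'I_n -> {poly R}) (x : 'I_n -> X)
    (f : R -> X) : (forall i, size (e i) <= r.+1)%N ->
  (forall t, I t -> f t = \sum_i (e i).[t] *: x i) -> polyfun I r f.
Proof.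
move=> szq ft; exists (fun k => \sum_i (e i)`_k *: x i) => t /ft ->.
under [RHS]eq_bigr do rewrite scaler_sumr.
rewrite exchange_big; apply: eq_bigr => i _.
rewrite (horner_coef_wide _ (szq i)) scaler_suml.
by apply: eq_bigr => k _; rewrite scalerA mulrC.
Qed.

Lemma continuous_sum_horner (n : nat) (e : 'I_n -> {poly R}) (x : 'I_n -> X) :
  continuous (fun t => \sum_i (e i).[t] *: x i).
Proof.
move=> t; apply: cvg_big => [|i _]; first exact: add_continuous.
by apply: cvgZr_tmp; exact: continuous_horner.
Qed.

Lemma is_derive_sum_horner (n : nat) (e : 'I_n -> {poly R}) (x : 'I_n -> X) (t : R) :
  is_derive t 1 (fun t => \sum_i (e i).[t] *: x i) (\sum_i (e i)^`().[t] *: x i).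
Proof.
have h (i : 'I_n) : is_derive t (1:R) (fun t => (e i).[t] *: x i) ((e i)^`().[t] *: x i).
  have de : differentiable (horner (e i)) t by apply/derivable1_diffP/derivable_horner.
  have dex := differentiableZl (x i) de.
  apply: DeriveDef; first exact/derivable1_diffP.
  by rewrite -derive1E derive1E'// diffZl//= -derive1E'// -derivE.
have := is_derive_sum h.
by congr (is_derive _ _ _ _); apply/funext => s; rewrite fct_sumE.
Qed.

Lemma polyfun_derive1 (a b : R) (r : nat) (x : 'I_r.+1 -> X) (f : R -> X) :
  (forall t, a < t < b -> f t = \sum_(i < r.+1) ('X^i : {poly R}).[t] *: x i) ->
  forall t, a < t < b -> derive1 f t = \sum_(i < r.+1) ('X^i : {poly R})^`().[t] *: x i.
Proof.
move=> fx t tab; rewrite derive1E.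
rewrite (@near_eq_derive _ _ _ _ (fun t => \sum_(i < r.+1) ('X^i : {poly R}).[t] *: x i)).
  by have [_ ->] := is_derive_sum_horner _ (fun i : 'I_r.+1 => 'X^i) x t.
have tI : t \in `]a, b[ by rewrite in_itv.
near=> s; apply: fx.
have : s \in `]a, b[ by near: s; exact: near_in_itvoo.
by rewrite in_itv.
Unshelve. all: by end_near. Qed.

(** If q_i is the scalar projection of 'X^i, then sum_i q_i(t) x_i satisfies the
    conditions defining the projection of sum_i t^i x_i: its error against
    sum_j t^j v_j is sum_ij <x_i, v_j> times the integral of (t^i - q_i) t^j.
    Hence the choice operator does not fall back on its default value. *)
Lemma L2proj_polyfun (a b : R) (r n : nat) (f : R -> X) : a < b ->
  polyfun `]a, b[%classic r f ->
  polyfun `]a, b[%classic n (L2proj ip `]a, b[%classic n f) /\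
  forall V, polyfun `]a, b[%classic n V ->
    (\int[lebesgue_measure]_(t in `]a, b[)
       (ip (f t - L2proj ip `]a, b[%classic n f t) (V t))%:E = 0)%E.
Proof.
move=> ab /polyfunP[x fx]; rewrite /L2proj; case: xgetP => [P _ []//|noP].
have proj (i : 'I_r.+1) : {q : {poly R} | (size q <= n.+1)%N &
    forall j, (j < n.+1)%N -> @pint R a b (('X^i - q) * 'X^j) = 0}.
  by apply/cid2; exact: scalar_projection.
pose q i := s2val (proj i).
pose P t := \sum_i (q i).[t] *: x i.
case: (noP P); split.
  apply: (polyfun_sum_horner _ _ _ q x) => // i; exact: (s2valP (proj i)).
move=> V /polyfunP[v Vv].
rewrite -[RHS]/((0 : R)%:E); transitivity (pint (a := a) (b := b)
  (\sum_i \sum_j ip (x i) (v j) *: (('X^i - q i) * 'X^j)))%:E; last first.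
  congr (_%:E); rewrite linear_sum big1// => i _; rewrite linear_sum big1// => j _.
  by rewrite linearZ /= (s2valP' (proj i)) ?scaler0.
rewrite -integral_horner//; apply: eq_integral => t; rewrite inE => tI.
rewrite -ip_sum_horner fx // Vv // -sumrB; congr (ip _ _)%:E.
by apply: eq_bigr => i _; rewrite -scalerBl !hornerE.
Qed.

Lemma continuous_eq_itv_endpoints (a b : R) (f g : R -> X) : a < b ->
  {within `[a, b], continuous f} -> continuous g ->
  (forall t, a < t < b -> f t = g t) -> f a = g a /\ f b = g b.
Proof.
move=> ab /(continuous_within_itvP _ ab)[_ fa fb] cg fg.
split.
- apply: (@norm_cvg_unique _ _ (f @ a^'+)) => //.
  apply: cvg_trans (cvg_at_right_filter (cg a)).
  apply: near_eq_cvg; near=> t; rewrite fg//.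
  by apply/andP; split; near: t; [exact: nbhs_right_gt|exact: nbhs_right_lt].
- apply: (@norm_cvg_unique _ _ (f @ b^'-)) => //.
  apply: cvg_trans (cvg_at_left_filter (cg b)).
  apply: near_eq_cvg; near=> t; rewrite fg//.
  by apply/andP; split; near: t; [exact: nbhs_left_gt|exact: nbhs_left_lt].
Unshelve. all: by end_near. Qed.

(** * Conservation of the norm *)

Lemma cG_step_norm_eq (a b : R) (r : nat) (F : R -> X -> X) (U : R -> X) : a < b ->
  induced_norm ip -> (0 < r)%N ->
  (forall v t, a < t < b -> ip (F t v) v = 0) ->
  {within `[a, b], continuous U} ->
  polyfun `]a, b[%classic r U ->
  (forall V, polyfun `]a, b[%classic r.-1 V ->
     (\int[lebesgue_measure]_(t in `]a, b[)
       (ip (derive1 U t - F t (L2proj ip `]a, b[%classic r.-1 U t)) (V t))%:E = 0)%E) ->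
  `|U b| = `|U a|.
Proof.
move=> ab ipn r0 F0 cU pU scheme.
have [pP orthP] := L2proj_polyfun a b r r.-1 U ab pU.
set P := L2proj _ _ _ _ in scheme pP orthP.
move: (pU) => /polyfunP[x Ux]; move: (pP) => /polyfunP[y Py].
have U'x := polyfun_derive1 a b r x U Ux.
pose e (i : 'I_r.+1) : {poly R} := 'X^i.
pose e' (i : 'I_r.+1) : {poly R} := ('X^i)^`().
pose d (i : 'I_r.-1.+1) : {poly R} := 'X^i.
pose UU := \sum_i \sum_j ip (x i) (x j) *: (e i * e j).
pose U'U := \sum_i \sum_j ip (x i) (x j) *: (e' i * e j).
pose U'P := \sum_i \sum_j ip (x i) (y j) *: (e' i * d j).
have ipC u v : ip u v = ip v u by rewrite hermC expr0 mul1r.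
have pU' : polyfun `]a, b[%classic r.-1 (derive1 U).
  apply: (polyfun_sum_horner _ _ _ e' x) => [i|t tI]; last exact: U'x.
  rewrite prednK//; have Xi0 : 'X^i != 0 :> {poly R} by rewrite monic_neq0 ?monicXn.
  have := lt_size_deriv Xi0; rewrite size_polyXn ltnS => /leq_trans -> //.
  by rewrite -ltnS.
(* Test function V := P: the contribution of F vanishes pointwise. *)
have intU'P : pint (a := a) (b := b) U'P = 0.
  apply: EFin_inj; rewrite -integral_horner//; apply: etrans (scheme P pP).
  apply: eq_integral => t; rewrite inE => tI.
  rewrite -ip_sum_horner linearBl [X in _ - X](F0 _ _ tI) subr0 U'x//.
  by rewrite Py.
(* Test function V := U' in the orthogonality relation of the projection. *)
have intU'U : pint (a := a) (b := b) U'U = 0.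
  rewrite -[LHS]subr0 -{1}intU'P -linearB; apply: EFin_inj.
  rewrite -integral_horner//; apply: etrans (orthP _ pU').
  apply: eq_integral => t; rewrite inE => tI.
  rewrite hornerD hornerN -!ip_sum_horner [in RHS]ipC linearB U'x//.
  by rewrite Ux // Py.
have dUU : UU^`() = U'U + U'U.
  rewrite {2}/U'U exchange_big raddf_sum -big_split; apply: eq_bigr => i _.
  rewrite raddf_sum -big_split; apply: eq_bigr => j _.
  by rewrite /= derivZ derivM scalerDr [ip (x j) _]ipC [e' j * _]mulrC.
have eqU t : ip (\sum_i (e i).[t] *: x i) (\sum_i (e i).[t] *: x i) = UU.[t].
  exact: ip_sum_horner.
(* U agrees with its polynomial on the open step only; continuity extends this
   to both end points. *)
have [Ua Ub] := continuous_eq_itv_endpoints a b U _ ab cU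
  (continuous_sum_horner _ e x) Ux.
have := pint_deriv ab UU; rewrite dUU linearD/= intU'U addr0 => /esym/eqP.
by rewrite subr_eq0 !ipn Ua Ub !eqU => /eqP ->.
Qed.

End VectorPolynomials.

Theorem proposition2 (R : realType) (X : completeNormedModType R)
  (ip : {dot X for idfun}) (ip_norm : induced_norm ip)
  (T : R) (T_gt0 : 0 < T) (u0 : X) (F : R -> X -> X)
  (F_orth : forall (v : X) (t : R), 0 < t <= T -> ip (F t v) v = 0)
  (M : nat) (tau : nat -> R) (tauP : time_partition T M tau)
  (r : nat -> nat) (r_ge1 : forall m, (0 < m <= M)%N -> (1 <= r m)%N)
  (U : R -> X)
  (FU_L2 : forall m, (0 < m <= M)%N ->
     BochnerL2 (step tau m)
       (fun t => F t (L2proj ip (step tau m) (r m).-1 U t)))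
  (U_cG : cG_solution ip F u0 T M tau r U) :
  forall m, (m <= M)%N -> `|U (tau m)| = `|u0|.
Proof.
case: tauP => tau0 tauM tau_lt.
have tau_le i j : (i <= j <= M)%N -> tau i <= tau j.
  elim: j => [|j IH]; first by rewrite leqn0 => /andP[/eqP ->].
  rewrite leq_eqVlt => /andP[/predU1P[->//|ij] jM].
  by rewrite (le_trans (IH _)) ?ltW ?tau_lt// -ltnS ij ltnW.
elim=> [_|m IH mM]; first by rewrite tau0 (cG_init U_cG).
have mM' : (0 < m.+1 <= M)%N by [].
have tm0 : 0 <= tau m by rewrite -tau0 tau_le//= ltnW.
have tmT : tau m.+1 <= T by rewrite -tauM tau_le// mM leqnn.
rewrite -IH ?(ltnW mM)//.
apply: (@cG_step_norm_eq _ _ ip (tau m) (tau m.+1) (r m.+1) F U) => //.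
- exact: tau_lt.
- exact: r_ge1.
- move=> v t /andP[mt tm]; apply: F_orth.
  by rewrite (le_lt_trans tm0 mt) (le_trans (ltW tm) tmT).
- apply: continuous_subspaceW (cG_continuous U_cG).
  by apply: subset_itv; rewrite bnd_simp.
- exact: (cG_poly U_cG mM').
- exact: (cG_scheme U_cG mM').
Qed.
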